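(* Let $d \geq 3$ be an integer with $d \equiv 1 \pmod 6$, and let $h_d(x,y) = (y,\, -x + s_d(y))$, where $s_d$ is the polynomial defined in the context. Then $h_d$ has a cycle of integer points of length $\frac{8d+10}{3}$; that is, there is a point $P \in \mathbb{Z}^2$ that is periodic under $h_d$ with exact period $\frac{8d+10}{3}$ and whose orbit is contained in $\mathbb{Z}^2$.
   Context: For each integer $j \ge 0$ let $$c_{2j+1}(x) := \frac{1}{(2j+1)!}\, x\prod_{i=1}^{j}(x^2-i^2),$$ with empty products equal to $1$. For odd $d = 2k+1$ with $k \geq 0$ define $$s_{d}(x) = s_{2k+1}(x) := \sum_{j=0}^{k}(-1)^{k-j}c_{2j+1}(x) \in \mathbb{Q}[x].$$ *)

(* Defs.v *)
From mathcomp Require Import all_boot all_order all_algebra.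
Set Implicit Arguments.
Unset Strict Implicit.
Unset Printing Implicit Defensive.
Import Order.TTheory GRing.Theory Num.Theory.
Local Open Scope ring_scope.

(* [c_odd j] is c_{2j+1}; it is integer-valued on integers although its
   coefficients are rational. *)
Definition c_odd (j : nat) : {poly rat} :=
  ((2 * j + 1)`!%:R)^-1 *:
    ('X * \prod_(1 <= i < j.+1) ('X^2 - (i%:R ^+ 2)%:P)).

(* [s_odd k] is s_{2k+1}; the subtraction k - j never truncates, as j <= k. *)
Definition s_odd (k : nat) : {poly rat} :=
  \sum_(0 <= j < k.+1) (-1) ^+ (k - j) *: c_odd j.

(* Only meaningful for odd d = 2k+1, where d./2 = k. *)
Definition s_poly (d : nat) : {poly rat} := s_odd d./2.

Definition h_map (d : nat) (P : rat * rat) : rat * rat :=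
  (P.2, - P.1 + (s_poly d).[P.2]).

Definition integer_point (P : rat * rat) : Prop :=
  P.1 \is a Num.int /\ P.2 \is a Num.int.

Definition has_exact_period (T : Type) (f : T -> T) (n : nat) (x : T) : Prop :=
  [/\ (0 < n)%N, iter n f x = x &
      forall m : nat, (0 < m < n)%N -> iter m f x <> x].

(* Main.v *)
Require Import Defs.
From mathcomp Require Import all_boot all_order all_algebra.
From mathcomp Require Import zify ring lra.

(** Write k = 3 m for d = 6 m + 1.  On the integers, s_d satisfies
    s_d(x+1) = s_d(x) - s_d(x-1) + c_d(x), and c_d vanishes for |x| <= k while
    c_d(k+1) = 1.  Hence s_d is 6-periodic on [-k-1, k+1], with s_d(k) = 0,
    s_d(k+1) = 1, and s_d(k+2) = 2.  Starting from (-k-2, -k-2) the orbit then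
    drifts in blocks of eight steps, the i-th block starting at
    (6 i - k - 2, -k-2), and reaches (k+2, k+2) after 8 m + 3 steps.  Since h_d
    is odd, it comes back after 2 (8 m + 3) = (8 d + 10) / 3 steps. *)

Set Implicit Arguments.
Unset Strict Implicit.
Unset Printing Implicit Defensive.
Import Order.TTheory GRing.Theory Num.Theory.
Local Open Scope ring_scope.

(** * Values of c_{2j+1} and their second differences *)

Lemma horner_c_odd0 (x : rat) : (c_odd 0).[x] = x.
Proof.
by rewrite /c_odd big_geq // mulr1 hornerZ hornerX factS muln1 invr1 mul1r.
Qed.

Lemma horner_c_oddS (j : nat) (x : rat) :
  (c_odd j.+1).[x] = (c_odd j).[x] * (x ^+ 2 - j.+1%:R ^+ 2)
                       / ((2 * j%:R + 2) * (2 * j%:R + 3)).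
Proof.
rewrite /c_odd big_nat_recr //= mulrA !hornerZ hornerM.
rewrite hornerD hornerN hornerC hornerXn.
have -> : (2 * j.+1 + 1 = (2 * j + 1).+2)%N by lia.
rewrite !factS !natrM.
have F0 : ((2 * j + 1)`!%:R : rat) != 0 by rewrite pnatr_eq0 -lt0n fact_gt0.
have -> : (2 * j + 1).+2%:R = 2 * j%:R + 3 :> rat by ring.
have -> : (2 * j + 1).+1%:R = 2 * j%:R + 2 :> rat by ring.
have j0 : 0 <= j%:R :> rat by exact: ler0n.
field.
by rewrite F0 !lt0r_neq0 //; lra.
Qed.

Lemma horner_c_oddN (j : nat) (x : rat) : (c_odd j).[- x] = - (c_odd j).[x].
Proof.
elim: j => [|j IH]; first by rewrite !horner_c_odd0.
by rewrite !horner_c_oddS IH sqrrN !mulNr.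
Qed.

(** Since c_{2j+1}(x) is the binomial coefficient of x + j over 2j + 1, passing to c_{2j+3}(x + 1)
    raises both entries by two. *)
Lemma horner_c_odd_shift (j : nat) (x : rat) :
  (c_odd j.+1).[x + 1] = (c_odd j).[x] * (x + j%:R + 1) * (x + j%:R + 2)
                           / ((2 * j%:R + 2) * (2 * j%:R + 3)).
Proof.
elim: j => [|j IH]; first by rewrite horner_c_oddS !horner_c_odd0; field.
rewrite horner_c_oddS IH horner_c_oddS.
have j0 : 0 <= j%:R :> rat by exact: ler0n.
field.
by rewrite !lt0r_neq0 //; lra.
Qed.

(** This is Pascal's rule applied twice. Oddness moves x - 1 to -x + 1, where the shift formula
    applies, and every term becomes a multiple of c_{2j+1}(x). *)
Lemma horner_c_odd_diff2 (j : nat) (x : rat) :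
  (c_odd j.+1).[x + 1] + (c_odd j.+1).[x - 1]
    = 2 * (c_odd j.+1).[x] + (c_odd j).[x].
Proof.
have -> : x - 1 = - (- x + 1) by ring.
rewrite horner_c_oddN !horner_c_odd_shift horner_c_oddN horner_c_oddS.
have j0 : 0 <= j%:R :> rat by exact: ler0n.
field.
by rewrite !lt0r_neq0 //; lra.
Qed.

Lemma horner_c_odd_eq0 (j : nat) (x : int) :
  (`|x| <= j)%N -> (c_odd j).[x%:~R] = 0.
Proof.
elim: j => [|j IH] xj.
  by rewrite (_ : x = 0) ?horner_c_odd0 //; lia.
rewrite horner_c_oddS; case: (leqP `|x|%N j) => [/IH ->|xj'].
  by rewrite !mul0r.
have [->|->] : x = j.+1%:Z \/ x = - j.+1%:Z by lia.
  by rewrite subrr mulr0 mul0r.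
by rewrite rmorphN sqrrN subrr mulr0 mul0r.
Qed.

Lemma horner_c_odd_diag (j : nat) : (c_odd j).[j.+1%:R] = 1.
Proof.
elim: j => [|j IH]; first by rewrite horner_c_odd0.
rewrite -[j.+2]addn1 natrD horner_c_odd_shift IH.
have j0 : 0 <= j%:R :> rat by exact: ler0n.
field.
by rewrite !lt0r_neq0 //; lra.
Qed.

(** * Recurrence for s_{2k+1} *)

Lemma horner_s_odd0 (x : rat) : (s_odd 0).[x] = x.
Proof. by rewrite /s_odd big_nat1 subn0 expr0 scale1r horner_c_odd0. Qed.

Lemma horner_s_oddS (k : nat) (x : rat) :
  (s_odd k.+1).[x] = (c_odd k.+1).[x] - (s_odd k).[x].
Proof.
rewrite /s_odd big_nat_recr //= subnn expr0 scale1r hornerD addrC.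
congr (_ + _); rewrite -hornerN; congr (_.[x]).
rewrite -sumrN; apply: eq_big_nat => j /andP[_ jk].
by rewrite subSn // exprS mulN1r scaleNr.
Qed.

Lemma horner_s_oddN (k : nat) (x : rat) : (s_odd k).[- x] = - (s_odd k).[x].
Proof.
elim: k => [|k IH]; first by rewrite !horner_s_odd0.
by rewrite !horner_s_oddS IH horner_c_oddN; ring.
Qed.

(** The operator f(x+1) - f(x) + f(x-1) sends c_{2j+1} to c_{2j+1} + c_{2j-1}, so the alternating
    sum telescopes to its top term. *)
Lemma horner_s_odd_rec (k : nat) (x : rat) :
  (s_odd k).[x + 1] = (s_odd k).[x] - (s_odd k).[x - 1] + (c_odd k).[x].
Proof.
elim: k => [|k IH]; first by rewrite !horner_s_odd0 horner_c_odd0; ring.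
rewrite !horner_s_oddS IH; have := horner_c_odd_diff2 k x; lra.
Qed.

Lemma horner_s_odd_at0 (k : nat) : (s_odd k).[0] = 0.
Proof. by have := horner_s_oddN k 0; rewrite oppr0; lra. Qed.

Lemma horner_s_odd_at1 (k : nat) : (s_odd k).[1] = (-1) ^+ k.
Proof.
elim: k => [|k IH]; first by rewrite horner_s_odd0.
by rewrite horner_s_oddS IH (@horner_c_odd_eq0 k.+1 1) // exprS; ring.
Qed.

Lemma horner_s_odd_step (k : nat) (x : int) : (`|x| <= k)%N ->
  (s_odd k).[(x + 1)%:~R] = (s_odd k).[x%:~R] - (s_odd k).[(x - 1)%:~R].
Proof.
by move=> xk; rewrite rmorphD rmorphB horner_s_odd_rec horner_c_odd_eq0 ?addr0.
Qed.

(** As t^2 - t + 1 divides t^3 + 1, three homogeneous steps negate a pair of consecutive values. *)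
Lemma horner_s_odd_mul3 (k q : nat) : (3 * q <= k)%N ->
  (s_odd k).[(3 * q)%:Z%:~R] = 0
  /\ (s_odd k).[((3 * q)%:Z + 1)%:~R] = (-1) ^+ (k + q).
Proof.
elim: q => [|q IH] qk.
  by rewrite muln0 add0r horner_s_odd_at0 horner_s_odd_at1 addn0.
have [IH0 IH1] := IH ltac:(lia).
have E1 := @horner_s_odd_step k ((3 * q)%:Z + 1) ltac:(lia).
have E2 := @horner_s_odd_step k ((3 * q)%:Z + 2) ltac:(lia).
have E3 := @horner_s_odd_step k ((3 * q)%:Z + 3) ltac:(lia).
have e2 : (3 * q)%:Z + 1 + 1 = (3 * q)%:Z + 2 by ring.
have e0 : (3 * q)%:Z + 1 - 1 = (3 * q)%:Z by ring.
have e3 : (3 * q)%:Z + 2 + 1 = (3 * q)%:Z + 3 by ring.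
have e1 : (3 * q)%:Z + 2 - 1 = (3 * q)%:Z + 1 by ring.
have e2' : (3 * q)%:Z + 3 - 1 = (3 * q)%:Z + 2 by ring.
rewrite e2 e0 in E1; rewrite e3 e1 in E2; rewrite e2' in E3.
have -> : (3 * q.+1)%:Z = (3 * q)%:Z + 3 by lia.
rewrite E3 E2 E1 IH0 IH1 addnS exprS; split; ring.
Qed.

(** * Values of s_{2k+1} near and inside the periodic window, for k = 3m *)

Section PeriodicRange.

Variable m : nat.
Let k := (3 * m)%N.

Local Notation S x := ((s_odd k).[(x : int)%:~R]).

(** The six-periodic sequence is read downwards from the right end k + 1 of the window. *)
Definition hexa (j : nat) : rat := nth 0 [:: 1; 0; -1; -1; 0; 1] (j %% 6).

Lemma hexa_rec (j : nat) : hexa j.+2 = hexa j.+1 - hexa j.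
Proof.
rewrite /hexa -(addn2 j) -(addn1 j) -(modnDml j 2) -(modnDml j 1).
have : (j %% 6 < 6)%N by rewrite ltn_mod.
by case: (j %% 6)%N => [|[|[|[|[|[|//]]]]]].
Qed.

Lemma horner_s_odd_hexa (j : nat) : (j <= 2 * k + 2)%N ->
  S (k%:Z + 1 - j%:Z) = hexa j.
Proof.
have [S0 S1] := @horner_s_odd_mul3 k m (leqnn _).
elim/ltn_ind: j => -[|[|j]] IH jk.
(* The sign is +1 because k + m = 4m. *)
- rewrite subr0 S1 -signr_odd; suff -> : odd (k + m) = false by [].
  by rewrite /k oddD oddM addbb.
- by rewrite addrK S0.
have E := @horner_s_odd_step k (k%:Z - j%:Z) ltac:(lia).
have e2 : k%:Z + 1 - j.+2%:Z = k%:Z - j%:Z - 1 by lia.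
have e1 : k%:Z + 1 - j.+1%:Z = k%:Z - j%:Z by lia.
have e0 : k%:Z + 1 - j%:Z = k%:Z - j%:Z + 1 by lia.
rewrite hexa_rec -(IH j) -?(IH j.+1) ?e2 ?e1 ?e0; try lia.
by rewrite E; ring.
Qed.

Lemma horner_s_odd_hexa_int (x : int) (j : nat) : (j < 6)%N ->
  (`|x| <= k.+1)%N -> (6 %| k%:Z + 1 - x - j%:Z)%Z -> S x = hexa j.
Proof.
move=> j6 xk /dvdzP[q qE].
have -> : x = k%:Z + 1 - `|(k%:Z + 1 - x)%R|%N%:Z by lia.
rewrite horner_s_odd_hexa; last by lia.
by rewrite /hexa; congr (nth _ _ _); lia.
Qed.

(** Just outside the window c_{2k+1}(k+1) = 1 enters the recurrence, giving 1 - 0 + 1. *)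
Lemma horner_s_odd_border : S (k%:Z + 2) = 2.
Proof.
have S1 := @horner_s_odd_hexa 0 ltac:(lia).
have S0 := @horner_s_odd_hexa 1 ltac:(lia).
rewrite subr0 in S1; rewrite addrK in S0.
have -> : (k%:Z + 2)%:~R = (k%:Z + 1)%:~R + 1 :> rat by rewrite !rmorphD; ring.
rewrite horner_s_odd_rec S1.
have -> : (k%:Z + 1)%:~R - 1 = k%:Z%:~R :> rat by rewrite rmorphD addrK.
have -> : (k%:Z + 1)%:~R = k.+1%:R :> rat by rewrite -natr1 rmorphD.
by rewrite S0 horner_c_odd_diag.
Qed.

(** * The orbit, its half period and its exact period *)

(* Entries 8 and 9 are the first two entries of block i + 1. *)
Definition block (i r : nat) : int :=
  nth 0 [:: 6 * i%:Z - k%:Z - 2; - k%:Z - 2; k%:Z - 6 * i%:Z; k%:Z + 2;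
            6 * i%:Z - k%:Z + 2; - k%:Z - 1; k%:Z - 6 * i%:Z - 3; k%:Z + 1;
            6 * i%:Z - k%:Z + 4; - k%:Z - 2] r.

(** Under the bound, only the arguments k + 2 and -k - 2 leave the window; all others are evaluated
    by their residue mod 6, using that 6 divides 2k. *)
Lemma block_step (i r : nat) : (r < 8)%N -> (8 * i + r <= 8 * m + 2)%N ->
  (block i r.+2)%:~R = - (block i r)%:~R + S (block i r.+1).
Proof.
have S_hexa x j := @horner_s_odd_hexa_int x j.
move=> r8 ir.
suff [c -> ->] : exists2 c : int, S (block i r.+1) = c%:~R
    & block i r.+2 = - block i r + c by rewrite rmorphD rmorphN.
move: r8 ir; do 8?[case: r => [|r]]; rewrite /block //= => _ im.
- exists (- 2); last by lia.
  rewrite (_ : - k%:Z - 2 = - (k%:Z + 2)); last by lia.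
  by rewrite rmorphN horner_s_oddN horner_s_odd_border.
- by exists 0; [rewrite (S_hexa _ 1%N) //; lia | lia].
- by exists 2; [rewrite horner_s_odd_border | lia].
- by exists 1; [rewrite (S_hexa _ 5%N) //; lia | lia].
- by exists (- 1); [rewrite (S_hexa _ 2%N) //; lia | lia].
- by exists 0; [rewrite (S_hexa _ 4%N) //; lia | lia].
- by exists 1; [rewrite (S_hexa _ 0%N) //; lia | lia].
- by exists (- 1); [rewrite (S_hexa _ 3%N) //; lia | lia].
Qed.

Local Notation h := (h_map (6 * m + 1)).

Definition rat_point (p : int * int) : rat * rat := (p.1%:~R, p.2%:~R).

Definition start : rat * rat := rat_point (- k%:Z - 2, - k%:Z - 2).

Lemma s_poly_6m1 : s_poly (6 * m + 1) = s_odd k.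
Proof. by rewrite /s_poly; congr s_odd; rewrite /k; lia. Qed.

Lemma iter_block (i r : nat) : (r <= 8)%N -> (8 * i + r <= 8 * m + 3)%N ->
  iter (8 * i + r) h start = rat_point (block i r, block i r.+1).
Proof.
elim: i r => [|i IHi]; elim=> [|r IHr] r8 ir.
- by rewrite /start /block /=; congr rat_point; congr pair; lia.
- rewrite addnS iterS IHr ?(ltnW r8) //; last by lia.
  rewrite /h_map s_poly_6m1 /= /rat_point /=; congr pair.
  by rewrite block_step //; lia.
(* Entry 0 of the new block is entry 8 of the previous one, which is why [r = 8] is allowed. *)
- rewrite addn0 mulnS addnC IHi //; last by lia.
  by rewrite /block /=; congr rat_point; congr pair; lia.
- rewrite addnS iterS IHr ?(ltnW r8) //; last by lia.
  rewrite /h_map s_poly_6m1 /= /rat_point /=; congr pair.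
  by rewrite block_step //; lia.
Qed.

Lemma iter_first_half (n : nat) : (n <= 8 * m + 3)%N ->
  iter n h start
    = rat_point (block (n %/ 8) (n %% 8), block (n %/ 8) (n %% 8).+1).
Proof. by move=> nm; rewrite -iter_block; [congr iter|..]; lia. Qed.

Definition opp_point (p : rat * rat) : rat * rat := (- p.1, - p.2).

Lemma iter_opp_point (n : nat) (p : rat * rat) :
  iter n h (opp_point p) = opp_point (iter n h p).
Proof.
elim: n => //= n ->.
by rewrite /h_map /opp_point /= s_poly_6m1 horner_s_oddN opprD.
Qed.

(** Entries 3 and 4 of block m are k + 2 and 6m - k + 2, which agree as k = 3m. *)
Lemma iter_half : iter (8 * m + 3) h start = opp_point start.
Proof.
rewrite iter_block // /opp_point /start /rat_point /block /= -!rmorphN.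
by congr pair; congr (_%:~R); lia.
Qed.

Lemma iter_second_half (n : nat) :
  iter (n + (8 * m + 3)) h start = opp_point (iter n h start).
Proof. by rewrite iterD iter_half iter_opp_point. Qed.

Lemma iter_period : iter (16 * m + 6) h start = start.
Proof.
have -> : (16 * m + 6 = (8 * m + 3) + (8 * m + 3))%N by lia.
rewrite iter_second_half iter_half /opp_point /=.
by rewrite !opprK.
Qed.

Lemma rat_point_inj : injective rat_point.
Proof. by move=> [a b] [a' b'] [/intr_inj -> /intr_inj ->]. Qed.

(** The two corners occur only at i = r = 0 and at i = m, r = 3, which the strict bounds exclude. *)
Lemma block_neq (i r : nat) : (r < 8)%N -> (0 < 8 * i + r < 8 * m + 3)%N ->
  (block i r, block i r.+1) <> (- k%:Z - 2, - k%:Z - 2)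
  /\ (block i r, block i r.+1) <> (k%:Z + 2, k%:Z + 2).
Proof.
by do 8?[case: r => [|r]]; rewrite /block //= => _ ir;
  split=> -[]; lia.
Qed.

Lemma iter_neq_start (n : nat) : (0 < n < 16 * m + 6)%N ->
  iter n h start <> start.
Proof.
move=> n_bd; case: (ltngtP n (8 * m + 3)) => [n_lt|n_gt|->].
- rewrite iter_first_half; last by lia.
  have [] := @block_neq (n %/ 8) (n %% 8); rewrite ?ltn_mod //; first by lia.
  by move=> neq _ /rat_point_inj.
(* A return in the second half would put the opposite corner (k+2, k+2) strictly inside the first
   half. *)
- have -> : n = (n - (8 * m + 3) + (8 * m + 3))%N by lia.
  rewrite iter_second_half; set n' := (n - _)%N.
  rewrite iter_first_half; last by lia.
  have [] := @block_neq (n' %/ 8) (n' %% 8); rewrite ?ltn_mod //; first by lia.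
  move=> _ neq E; apply: neq; apply: rat_point_inj; move: E.
  rewrite /opp_point /start /rat_point /= -!rmorphN.
  move=> -[/intr_inj E1 /intr_inj E2].
  by congr pair; congr (_%:~R); lia.
- rewrite iter_half /opp_point /start /rat_point /= -!rmorphN.
  by case=> /intr_inj; lia.
Qed.

Lemma integer_point_iter (n : nat) : integer_point (iter n h start).
Proof.
have small j : (j <= 8 * m + 3)%N -> integer_point (iter j h start).
  by move/iter_first_half->; split; exact: intr_int.
elim/ltn_ind: n => n IH; case: (leqP n (8 * m + 3)) => [/small //|n_gt].
have -> : n = (n - (8 * m + 3) + (8 * m + 3))%N by lia.
rewrite iter_second_half; have [] := IH (n - (8 * m + 3))%N; first by lia.
by split; rewrite rpredN.
Qed.

End PeriodicRange.

Local Close Scope ring_scope.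

(* For d = 1 mod 6 the number 8 d + 10 is a multiple of 3, so the Euclidean
   quotient below is the exact one. *)
Theorem theorem2 (d : nat) (hd3 : 3 <= d) (hd6 : d = 1 %[mod 6]) :
  exists P : rat * rat,
    [/\ integer_point P,
        has_exact_period (h_map d) ((8 * d + 10) %/ 3) P
      & forall m : nat, integer_point (iter m (h_map d) P)].
Proof.
have {hd3 hd6}-> : d = 6 * (d %/ 6) + 1 by lia.
set m := d %/ 6; have -> : (8 * (6 * m + 1) + 10) %/ 3 = 16 * m + 6 by lia.
exists (start m); split; last exact: integer_point_iter.
  exact: (integer_point_iter m 0).
split; [lia | exact: iter_period | exact: iter_neq_start].
Qed.
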